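(* Let $k\ge1$ and $r\ge1$ be integers. Then for all sufficiently large $n$, $$\Delta^r(\Delta_k(n)):=\sum_{i=0}^{r}\binom{r}{i}(-1)^{r+i}\Delta_k(n+i)>0.$$
   Context: For an integer $k\ge1$, $\Delta_k(n)$ is defined by $\sum_{n\ge0}\Delta_k(n)q^n=\prod_{m\ge1}\frac{(1-q^{2m})(1-q^{(2k+1)m})}{(1-q^m)^3(1-q^{(4k+2)m})}$. *)

(* Defs.v *)
From mathcomp Require Import all_boot all_order all_algebra.
Set Implicit Arguments. Unset Strict Implicit. Unset Printing Implicit Defensive.
Import GRing.Theory Num.Theory.
Local Open Scope ring_scope.

(* Truncation to degree <= n*d of the geometric series 1/(1 - q^d)
   = sum_{j>=0} q^(d j); for d >= 1 this agrees with 1/(1-q^d) modulo q^(n+1). *)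
Definition geom_trunc (d n : nat) : {poly int} := \sum_(j < n.+1) 'X^(d * j).

(* A polynomial agreeing modulo q^(n+1) with the product
   prod_{m>=1} (1-q^{2m})(1-q^{(2k+1)m}) / ((1-q^m)^3 (1-q^{(4k+2)m})):
   factors with m > n are 1 mod q^(n+1). *)
Definition Delta_poly (k n : nat) : {poly int} :=
  \prod_(1 <= m < n.+1)
     ((1 - 'X^(2 * m)) * (1 - 'X^((2 * k + 1) * m))
      * (geom_trunc m n) ^+ 3 * geom_trunc ((4 * k + 2) * m) n).

Definition Delta (k n : nat) : int := (Delta_poly k n)`_n.

(* Main.v *)
(** The r-th difference is the coefficient of q^(n+r) in (1-q)^r A(q), where
    A(q) = prod_((2k+1) not dividing m) (1+q^m) / prod_m (1-q^m)^2.
    Choose r+4 distinct exponents a for which the polynomials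
    [a] = (1-q^a)/(1-q) are pairwise coprime, and split (1-q)^r A = G B with
    G = (1-q)^r / prod_a (1-q^a) = 1 / ((1-q)^4 prod_a [a]).  By partial
    fractions (Bezout) the terms 1/[a] contribute bounded coefficients to G,
    while the pole of order 4 at q = 1 contributes a cubic polynomial with
    positive leading coefficient, so G_i >= i^2 for i >= J and G_i >= -M for
    all i.  The cofactor B has nonnegative coefficients, and its logarithmic
    derivative q B'/B has k-th coefficient at most 3 k^2, so that
    m B_m <= 3 sum_i i^2 B_(m-i).  Hence each of the J last coefficients of B
    is O(1/N) times S = sum_i i^2 B_(N-i), and (G B)_N >= (1 - O(1/N)) S > 0.

    Power series are represented by polynomials modulo 'X^n. *)
Require Import Defs.
From mathcomp Require Import all_boot all_order all_algebra.
From mathcomp Require Import zify ring lra.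
Import Order.TTheory GRing.Theory Num.Theory.
Local Open Scope ring_scope.

(** * Truncated power series and their inverses *)

Section CongruenceModXn.
Variable R : comNzRingType.
Implicit Types (p q : {poly R}) (n : nat).

Definition congX n p q := forall i, (i < n)%N -> p`_i = q`_i.

Lemma congX_refl n p : congX n p p. Proof. by []. Qed.

Lemma congX_sym n p q : congX n p q -> congX n q p.
Proof. by move=> pq i /pq. Qed.

Lemma congX_trans n q p s : congX n p q -> congX n q s -> congX n p s.
Proof. by move=> pq qs i ltin; rewrite pq ?qs. Qed.

Lemma congX_le m n p q : (m <= n)%N -> congX n p q -> congX m p q.
Proof. by move=> lemn pq i ltim; apply/pq/(leq_trans ltim). Qed.

Lemma congXM n p q s t : congX n p q -> congX n s t -> congX n (p * s) (q * t).
Proof.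
move=> pq st i ltin; rewrite !coefM; apply: eq_bigr => j _.
have lej: (j <= i)%N by rewrite -ltnS.
by rewrite pq ?st // (leq_ltn_trans _ ltin) // leq_subr.
Qed.

Lemma congX_prod n (I : Type) (s : seq I) (P : pred I) (F G : I -> {poly R}) :
  (forall i, P i -> congX n (F i) (G i)) ->
  congX n (\prod_(i <- s | P i) F i) (\prod_(i <- s | P i) G i).
Proof.
move=> FG; elim/big_rec2: _ => // i p q Pi pq; exact: congXM (FG i Pi) pq.
Qed.

Lemma congX_1DXn n m (c : R) : (n <= m)%N -> congX n (1 + c *: 'X^m) 1.
Proof.
move=> lenm i ltin; rewrite coefD coefZ coefXn.
by rewrite (ltn_eqF (leq_trans ltin lenm)) mulr0 addr0.
Qed.

Lemma coef_1BXM p i : ((1 - 'X) * p)`_i.+1 = p`_i.+1 - p`_i.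
Proof. by rewrite mulrBl mul1r coefB coefXM. Qed.

(* [p] is then a truncation of [(1 - 'X) ^- t.+1]. *)
Lemma coef_inv_1BX n t p :
    congX n ((1 - 'X) ^+ t.+1 * p) 1 ->
  forall i, (i < n)%N -> p`_i = 'C(i + t, t)%:R.
Proof.
have coef0_inv s q : (0 < n)%N -> congX n ((1 - 'X) ^+ s * q) 1 -> q`_0 = 1.
  move=> n_gt0 /(_ 0%N n_gt0); rewrite coef0M -!horner_coef0 !hornerE.
  by rewrite subr0 expr1n mul1r.
elim: t p => [|t IHt] p invp i ltin.
  have n_gt0 := leq_ltn_trans (leq0n i) ltin.
  rewrite bin0; elim: i ltin => [|i IHi] ltin; first exact: coef0_inv invp.
  move: (invp i.+1 ltin); rewrite expr1 coef_1BXM coefC /= => /eqP.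
  by rewrite subr_eq0 => /eqP ->; apply: IHi; apply: ltnW.
have n_gt0 := leq_ltn_trans (leq0n i) ltin.
(* [(1 - 'X) * p] inverts the previous power, so successive coefficients of [p] differ by a known
   binomial coefficient and Pascal's rule applies. *)
have invp' : congX n ((1 - 'X) ^+ t.+1 * ((1 - 'X) * p)) 1.
  by rewrite mulrA -exprSr.
elim: i ltin => [|i IHi] ltin; first by rewrite (coef0_inv _ _ _ invp) // binn.
move: (IHt _ invp' _ ltin); rewrite coef_1BXM => /eqP.
rewrite subr_eq IHi 1?ltnW // => /eqP ->.
by rewrite -natrD addnS addSn binS addnS addSn addnC.
Qed.

Definition repunit a : {poly R} := \sum_(j < a) 'X^j.

Lemma repunitM1BX a : (1 - 'X) * repunit a = 1 - 'X^a.
Proof. by rewrite -[RHS]opprB subrX1 -mulNr opprB. Qed.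

Lemma repunit1 a : (repunit a).[1] = a%:R.
Proof.
rewrite horner_sum (eq_bigr (fun=> 1)) ?sumr_const ?card_ord //.
by move=> j _; rewrite hornerXn expr1n.
Qed.

(** [geom_trunc] over any ring, with the truncation order as first argument. *)
Definition geom n m : {poly R} := \sum_(j < n.+1) 'X^(m * j).

Lemma geomM1BX n m : (0 < m)%N -> congX n.+1 ((1 - 'X^m) * geom n m) 1.
Proof.
move=> m_gt0; have -> : (1 - 'X^m) * geom n m = 1 + (-1) *: 'X^(m * n.+1).
  rewrite scaleN1r; under [geom n m]eq_bigr do rewrite exprM.
  by rewrite -[1 - _]opprB mulNr -subrX1 opprB -exprM.
by apply: congX_1DXn; rewrite leq_pmull.
Qed.

End CongruenceModXn.
Arguments congX {R}.
Arguments congX_trans {R n} q [p s].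
Arguments congX_le {R} [m] n [p q].
Arguments repunit {R}.
Arguments geom {R}.

(** * Bounded inverses of products of coprime polynomials *)

Section PartialFractions.
Variable R : realFieldType.
Implicit Types (p q : {poly R}) (n : nat).

(** The sum of the absolute values of the coefficients of [v] serves as [L]. *)
Lemma normr_coefM v : exists2 L : R, 0 <= L & forall p i K,
  (forall j, (j <= i)%N -> `|p`_j| <= K) -> `|(v * p)`_i| <= L * K.
Proof.
elim/poly_ind: v => [|v c [L L_ge0 vL]].
  by exists 0 => // p i K _; rewrite mul0r coef0 normr0 mul0r.
exists (L + `|c|) => [|p i K pK]; first exact: addr_ge0.
have K_ge0 : 0 <= K := le_trans (normr_ge0 _) (pK i (leqnn i)).
rewrite mulrDl coefD mulrDl (le_trans (ler_normD _ _)) // lerD //; last first.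
  by rewrite coefCM normrM ler_wpM2l ?pK.
rewrite -mulrA -commr_polyX mulrA coefMX.
case: eqP => [_|/eqP i_neq0]; first by rewrite normr0 mulr_ge0.
by apply: vL => j lej; apply: pK; lia.
Qed.

(** [C] is uniform in the truncation order [n]: it bounds the whole power series 1/q. *)
Definition bounded_inv q := exists2 C : R, 0 <= C & forall n p,
  congX n (q * p) 1 -> forall i, (i < n)%N -> `|p`_i| <= C.

(** A Bezout relation u q1 + v q2 = 1 gives 1/(q1 q2) = u/q2 + v/q1. *)
Lemma bounded_invM q1 q2 :
  coprimep q1 q2 -> bounded_inv q1 -> bounded_inv q2 -> bounded_inv (q1 * q2).
Proof.
move=> /Bezout_eq1_coprimepP[[u v] /= uv1] [C1 C1_ge0 bq1] [C2 C2_ge0 bq2].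
have [[Lu Lu_ge0 uL] [Lv Lv_ge0 vL]] := (normr_coefM u, normr_coefM v).
exists (Lu * C2 + Lv * C1) => [|n p invp i ltin]; first by rewrite addr_ge0 ?mulr_ge0.
have -> : p = u * (q1 * p) + v * (q2 * p) by rewrite !mulrA -mulrDl uv1 mul1r.
rewrite coefD (le_trans (ler_normD _ _)) // lerD //.
  apply: uL => j lej; apply: (bq2 n); last exact: leq_ltn_trans ltin.
  by rewrite mulrA (mulrC q2).
apply: vL => j lej; apply: (bq1 n); last exact: leq_ltn_trans ltin.
by rewrite mulrA.
Qed.

Lemma coef_geom n m i : (0 < m)%N -> (i <= n)%N ->
  (geom n m : {poly R})`_i = (m %| i)%:R.
Proof.
move=> m_gt0 lein; rewrite coef_sum; under eq_bigr do rewrite coefXn.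
have [/dvdnP[j Dj]|ndvd] := boolP (m %| i)%N; last first.
  rewrite big1 // => j _; case: eqP => // Di.
  by rewrite Di dvdn_mulr in ndvd.
have ltjn : (j < n.+1)%N by rewrite ltnS (leq_trans _ lein) // Dj leq_pmulr.
rewrite (bigD1 (Ordinal ltjn)) //= Dj mulnC eqxx big1 ?addr0 // => l.
by rewrite -val_eqE /= eqn_pmul2l // eq_sym => /negPf->.
Qed.

(** 1/[a] = (1-q)/(1-q^a), and the coefficients of 1/(1-q^a) are 0 or 1. *)
Lemma bounded_inv_repunit a : (0 < a)%N -> bounded_inv (repunit a).
Proof.
move=> a_gt0; have [L L_ge0 bL] := normr_coefM (1 - 'X).
exists L => // n p invp i ltin.
have cong_p : congX n p ((1 - 'X) * geom n a).
  have geom_n : congX n (1 : {poly R}) ((1 - 'X^a) * geom n a).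
    by apply/congX_sym/(congX_le _ (leqnSn n))/geomM1BX.
  rewrite -[X in congX _ X]mul1r; apply: (congX_trans ((1 - 'X^a) * geom n a * p)).
    exact: congXM.
  have -> : (1 - 'X^a) * geom n a * p = (1 - 'X) * geom n a * (repunit a * p).
    by rewrite -repunitM1BX; ring.
  by rewrite -[X in congX _ _ X]mulr1; apply: congXM.
rewrite cong_p // -[L]mulr1; apply: bL => j lej.
have lejn : (j <= n)%N by rewrite (leq_trans lej) // ltnW.
by rewrite coef_geom // ger0_norm ?ler0n // lern1; case: dvdn.
Qed.

(** [b+1] = 1 + q[b], and [a] divides [b] when a divides b. *)
Lemma coprimep_repunit a b : (a %| b)%N -> coprimep (repunit a : {poly R}) (repunit b.+1).
Proof.
case/dvdnP=> c ->; apply/Bezout_eq1_coprimepP.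
exists (- ('X * \sum_(j < c) 'X^a ^+ j), 1) => /=.
suff -> : repunit (c * a).+1 = 1 + 'X * (\sum_(j < c) 'X^a ^+ j * repunit a) :> {poly R}.
  by rewrite mul1r mulNr -mulrA mulr_suml addrC addrK.
rewrite {1}/repunit big_ord_recl expr0; congr (1 + _).
under eq_bigr do rewrite exprS.
rewrite -mulr_sumr -mulr_suml; congr ('X * _).
apply: (mulfI (_ : 1 - 'X != 0)); last first.
  rewrite mulrCA !repunitM1BX mulnC exprM -[1 - 'X^a]opprB mulrN mulrC.
  by rewrite -subrX1 opprB.
by rewrite -oppr_eq0 opprB polyXsubC_eq0.
Qed.

(** As in Euclid's argument, the next exponent is one plus the product of the previous ones; its
    repunit is coprime to all the earlier ones. *)
Lemma exists_bounded_inv_repunits s : exists S : seq nat,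
  [/\ size S = s, uniq S, all (leq 1) S
    & bounded_inv (\prod_(a <- S) repunit a : {poly R})].
Proof.
suff [S [sS uS S_gt1 bS]]: exists S : seq nat,
    [/\ size S = s, uniq S, all (leq 2) S
      & bounded_inv (\prod_(a <- S) repunit a : {poly R})].
  by exists S; split=> //; apply: sub_all S_gt1 => a /ltnW.
elim: s => [|s [S [sS uS S_gt1 bS]]].
  exists [::]; split=> //; rewrite big_nil; exists 1 => // n p invp i ltin.
  by rewrite -[p]mul1r invp // coefC; case: eqP; rewrite ?normr1 ?normr0.
pose b := (\prod_(a <- S) a)%N.
have S_dvd a : a \in S -> (a %| b)%N by move=> Sa; rewrite /b (big_rem a) // dvdn_mulr.
have b_gt0 : (0 < b)%N.
  rewrite /b big_seq prodn_cond_gt0 // => a /(allP S_gt1); exact: ltnW.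
exists (b.+1 :: S); split; rewrite /= ?sS ?S_gt1 ?ltnS ?b_gt0 //.
  rewrite uS andbT; apply/negP => /S_dvd; apply/negP.
  by rewrite gtnNdvd.
rewrite big_cons; apply: bounded_invM => //; last exact: bounded_inv_repunit.
rewrite coprimep_sym big_seq.
apply: (big_rec (fun p => coprimep p _)); first exact: coprime1p.
move=> a p Sa cop; rewrite coprimepMl cop andbT; exact/coprimep_repunit/S_dvd.
Qed.

End PartialFractions.

(** * Growth from the pole of order 4, and positivity of convolutions *)

Section CubicGrowth.
Variable R : archiRealFieldType.
Implicit Types (p q : {poly R}) (n : nat).

(** With u q + v (1-X)^4 = 1 and u = u(1) + w (1-X), the inverse is u(1)/(1-X)^4 + w/(1-X)^3 + v/q:
    a cubic main term with u(1) = 1/q(1) > 0, a quadratic error and a bounded error. *)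
Lemma coef_inv_lower_bound q : bounded_inv R q -> 0 < q.[1] ->
  exists J : nat, exists2 M : R, 0 <= M & forall n p,
  congX n ((1 - 'X) ^+ 4 * q * p) 1 -> forall i, (i < n)%N ->
  - M <= p`_i /\ ((J <= i)%N -> (i ^ 2)%:R <= p`_i).
Proof.
move=> [C C_ge0 bq] q1_gt0.
have : coprimep q ((1 - 'X) ^+ 4).
  rewrite coprimep_expr // -opprB -scaleN1r coprimepZr ?oppr_eq0 ?oner_eq0 //.
  by rewrite coprimep_XsubC rootE gt_eqF.
case/Bezout_eq1_coprimepP=> -[u v] /= uv1.
have u1q1 : u.[1] * q.[1] = 1.
  have X1 : (1 - 'X : {poly R}).[1] = 0 by rewrite !hornerE subrr.
  move/(congr1 (horner^~ 1)): uv1.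
  by rewrite hornerD !hornerM X1 !mulr0 addr0 hornerC.
have u1_gt0 : 0 < u.[1] by rewrite -(pmulr_lgt0 _ q1_gt0) u1q1.
have [w Du] : exists w, u = u.[1]%:P + w * (1 - 'X).
  have /factor_theorem[w Dw] : root (u - u.[1]%:P) 1 by rewrite rootE !hornerE subrr.
  by exists (- w); rewrite mulNr -mulrN opprB -Dw addrC subrK.
have [[Lv Lv_ge0 vL] [Lw Lw_ge0 wL]] := (normr_coefM R v, normr_coefM R w).
pose K := Lv * C; have K_ge0 : 0 <= K by rewrite mulr_ge0.
(* Put D = C(i+2,2). Since 3 C(i+3,3) = (i+3) D, for i >= [J] the main term is at least (Lw + 2 + K)
   D. This absorbs both errors and leaves 2D = (i+1)(i+2) >= i^2. *)
pose J := Num.bound (3 * (Lw + 2 + K) / u.[1]).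
have J_large : 3 * (Lw + 2 + K) <= J%:R * u.[1].
  rewrite -ler_pdivrMr //; apply/ltW/archi_boundP.
  by rewrite divr_ge0 ?mulr_ge0 ?addr_ge0 // ltW.
exists J, (Lw * 'C(J + 2, 2)%:R + K) => [|n p invp i ltin].
  by rewrite addr_ge0 ?mulr_ge0.
have p_lb : u.[1] * 'C(i + 3, 3)%:R - Lw * 'C(i + 2, 2)%:R - K <= p`_i.
  have -> : p = u.[1]%:P * (q * p) + w * ((1 - 'X) * (q * p)) + v * ((1 - 'X) ^+ 4 * p).
    rewrite -[LHS]mul1r -[X in X * p = _]uv1 {1}Du; ring.
  have cq : congX n ((1 - 'X) ^+ 4 * (q * p)) 1 by rewrite mulrA.
  have c3 : congX n ((1 - 'X) ^+ 3 * ((1 - 'X) * (q * p))) 1 by rewrite mulrA -exprSr.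
  have c1 : congX n (q * ((1 - 'X) ^+ 4 * p)) 1 by rewrite mulrA (mulrC q).
  rewrite !coefD coefCM (coef_inv_1BX _ _ _ _ cq) //.
  have /ler_normlP[] : `|(w * ((1 - 'X) * (q * p)))`_i| <= Lw * 'C(i + 2, 2)%:R.
    apply: wL => j lej; rewrite (coef_inv_1BX _ _ _ _ c3) ?(leq_ltn_trans lej) //.
    rewrite ger0_norm // ler_nat leq_bin2l // leq_add2r //.
  have /ler_normlP[] : `|(v * ((1 - 'X) ^+ 4 * p))`_i| <= K.
    by apply: vL => j lej; apply: (bq n); rewrite ?(leq_ltn_trans lej).
  by lra.
have bin3 : 3 * 'C(i + 3, 3)%:R = (i%:R + 3) * 'C(i + 2, 2)%:R :> R.
  by rewrite -natrD -!natrM !addn3 addn2 -mul_bin_diag.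
have bin2 : 2 * 'C(i + 2, 2)%:R = (i%:R + 2) * (i%:R + 1) :> R.
  by rewrite natr1 -natrD -!natrM addn2 -mul_bin_diag bin1 mulnC.
have i_ge0 : 0 <= i%:R :> R := ler0n _ _.
have [ltiJ|leJi] := ltnP i J.
  split=> //.
  apply: le_trans p_lb.
  have : 'C(i + 2, 2)%:R <= 'C(J + 2, 2)%:R :> R.
    by rewrite ler_nat leq_bin2l // leq_add2r ltnW.
  have : 0 <= u.[1] * 'C(i + 3, 3)%:R by rewrite mulr_ge0 // ltW.
  move=> h1 /(ler_wpM2l Lw_ge0); lra.
have p_large : (i ^ 2)%:R <= p`_i.
  apply: le_trans p_lb; rewrite natrX.
  move: bin2 bin3; set D := 'C(i + 2, 2)%:R; set E := 'C(i + 3, 3)%:R => bin2 bin3.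
  have D_ge1 : 1 <= D by nra.
  have : J%:R * u.[1] <= i%:R * u.[1] by rewrite ler_wpM2r ?ler_nat // ltW.
  have D_ge0 : 0 <= D by lra.
  move/(le_trans J_large)=> le1.
  have le2 : 3 * (Lw + 2 + K) * D <= (i%:R + 3) * u.[1] * D.
    by rewrite ler_wpM2r //; lra.
  have le3 : (Lw + 2 + K) * D <= u.[1] * E.
    have : (i%:R + 3) * u.[1] * D = u.[1] * (3 * E) by rewrite bin3; ring.
    by lra.
  have le4 : K <= K * D by rewrite ler_peMr.
  by nra.
split=> //; apply: le_trans p_large; rewrite (le_trans _ (ler0n _ _)) //.
by rewrite oppr_le0 addr_ge0 ?mulr_ge0.
Qed.

(* [S] is comparable to each [b (N - i)]: by [b_growth], [(N - i) b (N - i) <= c S]. *)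
Lemma convolution_gt0 (J : nat) (M c : R) : 0 <= M -> 0 <= c -> exists N0 : nat,
  forall (N : nat) (p b : nat -> R), (N0 <= N)%N ->
    (forall m, 0 <= b m) -> 0 < b 0%N ->
    (forall m, (m <= N)%N -> m%:R * b m <= c * \sum_(i < m.+1) (i ^ 2)%:R * b (m - i)%N) ->
    (forall i, (i <= N)%N -> - M <= p i) ->
    (forall i, (J <= i <= N)%N -> (i ^ 2)%:R <= p i) ->
  0 < \sum_(i < N.+1) p i * b (N - i)%N.
Proof.
move=> M_ge0 c_ge0.
(* [M'] is such that p i >= i^2 - M' for i < J; the total loss is at most M' J c S / (N - J), which
   is below S once N - J > [A]. *)
pose M' := M + (J ^ 2)%:R; pose A := M' * J%:R * c.
have M'_ge0 : 0 <= M' by rewrite addr_ge0.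
have A_ge0 : 0 <= A by rewrite !mulr_ge0.
exists (J + (Num.bound A).+1)%N => N p b leN0 b_ge0 b0_gt0 b_growth p_lb p_large.
have ltJN : (J < N)%N by lia.
pose S := \sum_(i < N.+1) (i ^ 2)%:R * b (N - i)%N.
have S_gt0 : 0 < S.
  rewrite /S big_ord_recr /= subnn ltr_wpDl //.
    by apply: sumr_ge0 => i _; rewrite mulr_ge0.
  by rewrite mulr_gt0 // ltr0n expn_gt0; apply/orP; left; lia.
(* The growth bound at N - j involves a sum which, after shifting the index by j, is termwise at
   most the tail of [S]. *)
have b_le (j : nat) : (j < J)%N -> (N - J)%:R * b (N - j)%N <= c * S.
  move=> ltjJ; apply: (@le_trans _ _ ((N - j)%:R * b (N - j)%N)).
    by rewrite ler_wpM2r // ler_nat leq_sub2l // ltnW.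
  apply: le_trans (b_growth _ (leq_subr _ _)) _; rewrite ler_wpM2l //.
  have -> : S = \sum_(0 <= i < N.+1) (i ^ 2)%:R * b (N - i)%N by rewrite big_mkord.
  rewrite (@big_cat_nat _ _ _ j) //=; last by lia.
  rewrite -[X in X <= _]add0r lerD //.
    by apply: sumr_ge0 => i _; rewrite mulr_ge0.
  have -> : \sum_(j <= i < N.+1) (i ^ 2)%:R * b (N - i)%N
          = \sum_(i < (N - j).+1) ((i + j) ^ 2)%:R * b (N - (i + j))%N.
    by rewrite -{1}[j]add0n big_addn big_mkord subSn //; lia.
  apply: ler_sum => i _; rewrite [(i + j)%N]addnC subnDA ler_wpM2r //.
  by rewrite ler_nat leq_exp2r // leq_addl.
have p_sum : S - M' * \sum_(j < J) b (N - j)%N <= \sum_(i < N.+1) p i * b (N - i)%N.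
  have -> : \sum_(j < J) b (N - j)%N = \sum_(i < N.+1) (i < J)%N%:R * b (N - i)%N.
    have leJN : (J <= N.+1)%N by lia.
    rewrite (big_ord_widen _ (fun i => b (N - i)%N) leJN) big_mkcond /=.
    by apply: eq_bigr => i _; case: ltnP; rewrite ?mul1r ?mul0r.
  rewrite mulr_sumr -sumrB ler_sum // => i _.
  rewrite mulrA -mulrBl ler_wpM2r //.
  have leiN : (i <= N)%N by rewrite -ltnS.
  case: ltnP => [ltiJ|leJi]; last by rewrite mulr0 subr0 p_large ?leJi.
  have := p_lb _ leiN.
  have : (i ^ 2)%:R <= (J ^ 2)%:R :> R by rewrite ler_nat leq_exp2r // ltnW.
  by rewrite /M' mulr1; lra.
apply: lt_le_trans p_sum; rewrite subr_gt0.
have NJ_gt0 : 0 < (N - J)%:R :> R by rewrite ltr0n subn_gt0.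
rewrite -(ltr_pM2l NJ_gt0) mulrCA mulr_sumr.
apply: (@le_lt_trans _ _ (A * S)).
  have -> : A * S = M' * \sum_(j < J) (c * S).
    by rewrite sumr_const card_ord -mulr_natl /A; ring.
  by rewrite ler_wpM2l // ler_sum // => j _; apply: b_le.
rewrite ltr_pM2r //; apply: lt_le_trans (archi_boundP A_ge0) _.
by rewrite ler_nat; lia.
Qed.

End CubicGrowth.

(** * Bounds on logarithmic derivatives *)

Section LogarithmicDerivative.
Variable R : realFieldType.
Implicit Types (B c : {poly R}) (N m : nat).

(* Up to degree [N], the coefficients of ['X * B^`()] are at most those of
   [c * B], i.e. [c] dominates the logarithmic derivative ['X * B^`() / B]. *)
Definition logderiv_le N B c := [/\ forall i, 0 <= B`_i, 0 < B`_0
  & forall i, (i <= N)%N -> i%:R * B`_i <= (c * B)`_i].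

Lemma logderiv_le1 N : logderiv_le N 1 0.
Proof.
split=> [i||[|i] _]; rewrite ?mul0r ?coef0 ?coefC ?eqxx ?ler01 ?ltr01 ?mulr0 //.
by case: eqP; rewrite ?ler01.
Qed.

(** Logarithmic derivatives add by the Leibniz rule; nonnegative coefficients let each bound be
    multiplied by the other factor. *)
Lemma logderiv_leM N B1 c1 B2 c2 : logderiv_le N B1 c1 -> logderiv_le N B2 c2 ->
  logderiv_le N (B1 * B2) (c1 + c2).
Proof.
move=> [B1_ge0 B1_gt0 Bc1] [B2_ge0 B2_gt0 Bc2]; split=> [i||i leiN].
- by rewrite coefM sumr_ge0 // => j _; rewrite mulr_ge0.
- by rewrite coef0M mulr_gt0.
have -> : (c1 + c2) * (B1 * B2) = (c1 * B1) * B2 + B1 * (c2 * B2) by ring.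
rewrite coefD !coefM -big_split mulr_sumr ler_sum //= => j _.
have leji : (j <= i)%N by rewrite -ltnS.
have -> : i%:R * (B1`_j * B2`_(i - j)) =
    (j%:R * B1`_j) * B2`_(i - j) + B1`_j * ((i - j)%:R * B2`_(i - j)).
  by rewrite -{1}(subnKC leji) natrD; ring.
rewrite lerD // ?ler_wpM2r ?ler_wpM2l // ?Bc1 ?Bc2 ?(leq_trans _ leiN) //.
exact: leq_subr.
Qed.

Lemma logderiv_le_prod N M (P : pred nat) (B c : nat -> {poly R}) :
  (forall m, (0 < m)%N -> logderiv_le N (B m) (c m)) ->
  logderiv_le N (\prod_(1 <= m < M | P m) B m) (\sum_(1 <= m < M | P m) c m).
Proof.
move=> Bc; rewrite big_nat_cond [X in logderiv_le _ _ X]big_nat_cond.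
apply: (big_ind2 (logderiv_le N)); first exact: logderiv_le1.
  by move=> B1 c1 B2 c2; apply: logderiv_leM.
by move=> m /andP[/andP[m_gt0 _] _]; apply: Bc.
Qed.

Lemma logderiv_le_1DXn N m : (0 < m)%N -> logderiv_le N (1 + 'X^m) (m%:R *: 'X^m).
Proof.
move=> m_gt0; split=> [i||i _].
- by rewrite coefD coefC coefXn addr_ge0 //; case: eqP.
- by rewrite coefD coefC coefXn (ltn_eqF m_gt0) addr0.
rewrite mulrDr mulr1 coefD coefD coefC coefZ coefXn.
rewrite -scalerAl coefZ -exprD coefXn mulrDr.
have -> : i%:R * (if i == 0%N then 1 else 0) = 0 :> R.
  by case: eqP => [->|]; rewrite ?mul0r ?mulr0.
rewrite add0r; have -> : i%:R * (i == m)%:R = m%:R * (i == m)%:R :> R.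
  by case: eqP => [->|]; rewrite ?mulr0.
by rewrite lerDl mulr_ge0.
Qed.

(** For g = 1/(1-X^m), X g'/g = m X^m g, so the bound is an equality up to degree [N]. *)
Lemma logderiv_le_geom N m : (0 < m)%N ->
  logderiv_le N (geom N m) (m%:R *: 'X^m * geom N m).
Proof.
move=> m_gt0; have inv_g := geomM1BX R N m m_gt0.
split=> [i||i leiN].
- by rewrite coef_sum sumr_ge0 // => j _; rewrite coefXn.
- by rewrite coef_geom // dvdn0 ltr01.
pose g : {poly R} := geom N m; rewrite -/g in inv_g *.
(* The factor ['X] restores the degree of precision lost by differentiating. *)
have theta_inv : congX N.+1 ('X * ((1 - 'X^m) * g)^`()) 0.
  move=> [|j] ltjN; rewrite coefXM coef0 //= coef_deriv inv_g // coefC.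
  by rewrite mul0rn.
suff : congX N.+1 ('X * g^`()) (m%:R *: 'X^m * g * g).
  move/(_ i leiN) <-; rewrite coefXM.
  by case: i leiN => [|i] _; rewrite ?mul0r //= coef_deriv mulr_natl.
apply: (congX_trans ((1 - 'X^m) * g * ('X * g^`()))).
  by rewrite -[X in congX _ X]mul1r; apply: congXM => //; apply: congX_sym.
have -> : (1 - 'X^m) * g * ('X * g^`()) =
    g * ('X * ((1 - 'X^m) * g)^`()) + m%:R *: 'X^m * g * g.
  have Xm : 'X^m = 'X * 'X^(m.-1) :> {poly R} by rewrite -exprS prednK.
  rewrite derivM derivB derivC derivXn sub0r scaler_nat.
  rewrite -['X^m *+ m]mulr_natl -['X^(m.-1) *+ m]mulr_natl Xm.
  by move: ('X^(m.-1)) (g^`()) (m%:R) => Y g' c; ring.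
move=> j ltjN; rewrite coefD (congXM _ _ g g _ _ (congX_refl _ _ _) theta_inv) //.
  by rewrite mulr0 coef0 add0r.
Qed.

(** At most [k] indices contribute, each at most [k], whatever the length of the product. *)
Lemma coef_sum_le_sqr (P : pred nat) (c : nat -> {poly R}) M k :
  (forall m, (0 < m)%N -> (c m)`_k <= k%:R * (m <= k)%N%:R) ->
  (\sum_(1 <= m < M | P m) c m)`_k <= (k ^ 2)%:R.
Proof.
move=> c_le; rewrite coef_sum.
have sum_le : (\sum_(1 <= m < M) (m <= k) <= k)%N.
  elim: M => [|[|M] IHM]; [by rewrite big_geq | by rewrite big_geq |].
  rewrite big_nat_recr //=.
  have [leMk|ltkM] := leqP M.+1 k; last by rewrite addn0.
  rewrite addn1; apply: leq_ltn_trans leMk.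
  rewrite (@leq_trans (\sum_(1 <= m < M.+1) 1)%N) //.
    by apply: leq_sum => m _; apply: leq_b1.
  by rewrite sum_nat_const_nat muln1 subn1.
rewrite (@le_trans _ _ (\sum_(1 <= m < M) k%:R * (m <= k)%N%:R)) //.
  rewrite big_mkcond [leLHS]big_nat [leRHS]big_nat ler_sum // => m /andP[m_gt0 _].
  by case: (P m); [apply: c_le | rewrite mulr_ge0].
by rewrite -mulr_sumr -natr_sum -mulnn natrM ler_wpM2l // ler_nat.
Qed.

Lemma coef_logderiv_1DXn m k : (m%:R *: 'X^m : {poly R})`_k <= k%:R * (m <= k)%N%:R.
Proof.
rewrite coefZ coefXn; have [->|_] := eqVneq k m; first by rewrite leqnn.
by rewrite mulr0 mulr_ge0.
Qed.

Lemma coef_logderiv_geom N m k : (0 < m)%N -> (k <= N)%N ->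
  (m%:R *: 'X^m * geom N m : {poly R})`_k <= k%:R * (m <= k)%N%:R.
Proof.
move=> m_gt0 lekN; rewrite -scalerAl coefZ coefXnM.
case: ltnP => [_|lemk]; first by rewrite mulr0 mulr_ge0.
rewrite coef_geom //; last exact: leq_trans (leq_subr _ _) lekN.
by rewrite mulr1 -natrM ler_nat; case: dvdn; rewrite ?muln1 ?muln0.
Qed.

End LogarithmicDerivative.

(** * Factorization of the generating function *)

Section Decomposition.
Variable R : realFieldType.
Implicit Types (N m i k : nat).

Definition Delta_polyR k N : {poly R} :=
  \prod_(1 <= m < N.+1)
     ((1 - 'X^(2 * m)) * (1 - 'X^((2 * k + 1) * m))
      * geom N m ^+ 3 * geom N ((4 * k + 2) * m)).

Lemma map_Delta_poly k N : map_poly intr (Delta_poly k N) = Delta_polyR k N.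
Proof.
have map_geom m : map_poly intr (geom_trunc m N) = geom N m :> {poly R}.
  by rewrite rmorph_sum; apply: eq_bigr => j _; rewrite /= map_polyXn.
rewrite /Delta_poly rmorph_prod; apply: eq_bigr => m _.
by rewrite /= !rmorphM /= ?rmorphXn ?rmorphM /= !rmorphB !rmorph1 /= !map_polyXn !map_geom.
Qed.

Lemma congX_big_nat n (a b : nat) (P : pred nat) (F G : nat -> {poly R}) :
  (forall m, (a <= m < b)%N -> P m -> congX n (F m) (G m)) ->
  congX n (\prod_(a <= m < b | P m) F m) (\prod_(a <= m < b | P m) G m).
Proof.
move=> FG; rewrite big_nat_cond [X in congX _ _ X]big_nat_cond.
by apply: congX_prod => m /andP[? ?]; apply: FG.
Qed.

Lemma congX_big_nat1 n (a b : nat) (F : nat -> {poly R}) :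
  (forall m, (a <= m < b)%N -> congX n (F m) 1) ->
  congX n (\prod_(a <= m < b) F m) 1.
Proof.
move=> F1; have prod1 : \prod_(a <= m < b) 1 = 1 :> {poly R} by apply: big1_eq.
rewrite -[X in congX _ _ X]prod1.
by apply: congX_big_nat => m ? _; apply: F1.
Qed.

Lemma congX_1BXn n m : (n <= m)%N -> congX n (1 - 'X^m : {poly R}) 1.
Proof. by move/congX_1DXn=> /(_ R (-1)); rewrite scaleN1r. Qed.

Lemma congX_1PXn n m : (n <= m)%N -> congX n (1 + 'X^m : {poly R}) 1.
Proof. by move/congX_1DXn=> /(_ R 1); rewrite scale1r. Qed.

Lemma congX_geom_le n N m : (0 < m)%N -> (n <= N)%N ->
  congX n.+1 (geom N m : {poly R}) (geom n m).
Proof.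
by move=> m_gt0 lenN i lein; rewrite !coef_geom // (leq_trans _ lenN).
Qed.

Lemma congX_geom1 n N m : (n < m)%N -> (n <= N)%N ->
  congX n.+1 (geom N m : {poly R}) 1.
Proof.
move=> ltnm lenN i lein; have m_gt0 := leq_ltn_trans (leq0n n) ltnm.
rewrite coef_geom ?(leq_trans _ lenN) // coefC; case: i lein => [|i] lein /=.
  by rewrite dvdn0.
by rewrite gtnNdvd // (leq_ltn_trans _ ltnm).
Qed.

(** Allows all the values in an r-th difference to be read off one polynomial. *)
Lemma congX_Delta_polyR k n N : (n <= N)%N ->
  congX n.+1 (Delta_polyR k N) (Delta_polyR k n).
Proof.
move=> lenN; rewrite /Delta_polyR (@big_cat_nat _ _ _ n.+1) //=.
rewrite -[X in congX _ _ X]mulr1; apply: congXM.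
  apply: congX_big_nat => m /andP[m_gt0 _] _.
  have dm_gt0 : (0 < (4 * k + 2) * m)%N by rewrite muln_gt0 m_gt0 addn2.
  by do !apply: congXM => //; apply: congX_geom_le.
apply: congX_big_nat1 => m /andP[ltnm _].
rewrite [X in congX _ _ X](_ : 1 = 1 * 1 * 1 ^+ 3 * 1); last by rewrite expr1n !mulr1.
apply: congXM; last by apply: congX_geom1 => //; nia.
apply: congXM; last by do !apply: congXM => //; apply: congX_geom1.
by apply: congXM; apply: congX_1BXn; nia.
Qed.

Lemma prod_dvdn d N (F : nat -> {poly R}) : (0 < d)%N ->
  \prod_(1 <= m < (d * N).+1 | (d %| m)%N) F m = \prod_(1 <= m < N.+1) F (d * m)%N.
Proof.
move=> d_gt0; elim: N => [|N IHN]; first by rewrite muln0 !big_geq.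
have leN : (d * N <= d * N.+1)%N by rewrite leq_mul2l leqnSn orbT.
rewrite [RHS]big_nat_recr //= -IHN (@big_cat_nat _ _ _ (d * N).+1) //=; congr (_ * _).
(* In the block from dN + 1 to d(N+1), only the last index is a multiple of d. *)
rewrite big_mkcond big_nat_recr /=; last by rewrite mulnS -[X in (X < _)%N]add0n ltn_add2r.
rewrite dvdn_mulr // big_nat big1 ?mul1r // => m /andP[ltm ltm'].
case: dvdnP => // -[j Dm]; move: ltm ltm'; rewrite Dm [(j * d)%N]mulnC !ltn_pmul2l //.
by move=> ltNj; rewrite ltnS leqNgt ltNj.
Qed.

(** The range ends at a multiple of 2k+1, so that restoring the multiples of 2k+1 takes exactly [N]
    factors; factors beyond [N] are 1 modulo ['X^N.+1]. *)
Definition Delta_numerator k N : {poly R} :=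
  \prod_(1 <= m < ((2 * k + 1) * N).+1 | ~~ (2 * k + 1 %| m)%N) (1 + 'X^m).

(* The factors [1 - 'X^(2m)] of the numerator cancel one of the three
   [1 - 'X^m], leaving [1 + 'X^m]; those with [(2k+1) %| m] are cancelled
   in turn by [(1 - 'X^((2k+1)m)) / (1 - 'X^((4k+2)m))]. *)
Lemma congX_Delta_polyR_positive k N :
  congX N.+1 (Delta_polyR k N)
    (Delta_numerator k N * \prod_(1 <= m < N.+1) geom N m * \prod_(1 <= m < N.+1) geom N m).
Proof.
set d := (2 * k + 1)%N.
have d_gt0 : (0 < d)%N by rewrite /d addn1.
pose V : {poly R} := \prod_(1 <= m < N.+1) ((1 - 'X^(d * m)) * geom N ((4 * k + 2) * m)).
pose U : {poly R} := \prod_(1 <= m < N.+1) (1 + 'X^(d * m)).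
pose W : {poly R} := \prod_(1 <= m < N.+1) (1 + 'X^m).
set g := \prod_(1 <= m < N.+1) geom N m.
(* (1 + X^(dm))(1 - X^(dm)) = 1 - X^((4k+2)m), so [V] inverts [U]. *)
have UV1 : congX N.+1 (U * V) 1.
  rewrite -big_split; apply: congX_big_nat1 => m /andP[m_gt0 _] /=.
  have -> : (1 + 'X^(d * m)) * ((1 - 'X^(d * m)) * geom N ((4 * k + 2) * m))
      = (1 - 'X^((4 * k + 2) * m)) * geom N ((4 * k + 2) * m) :> {poly R}.
    rewrite mulrA; congr (_ * _).
    by rewrite mulrC -subr_sqr expr1n -exprM; congr (1 - 'X^_); rewrite /d; lia.
  by apply: geomM1BX; rewrite muln_gt0 m_gt0 addn2.
have W_eq : congX N.+1 W (Delta_numerator k N * U).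
  have leN : (N <= d * N)%N by rewrite leq_pmull.
  have -> : Delta_numerator k N * U = \prod_(1 <= m < (d * N).+1) (1 + 'X^m).
    by rewrite [RHS](bigID (fun m => d %| m)%N) /= prod_dvdn // mulrC.
  apply: congX_sym; rewrite (@big_cat_nat _ _ _ N.+1) //=.
  rewrite -[X in congX _ _ X]mulr1; apply: congXM => //.
  by apply: congX_big_nat1 => m /andP[ltNm _]; apply: congX_1PXn.
have D_eq : congX N.+1 (Delta_polyR k N) (W * V * (g * g)).
  rewrite /W /V /g -!big_split /=; apply: congX_big_nat => m /andP[m_gt0 _] _.
  set h := geom N ((4 * k + 2) * m); set f := geom N m.
  have -> : (1 - 'X^(2 * m)) * (1 - 'X^(d * m)) * f ^+ 3 * h
      = (1 - 'X^m) * f * ((1 + 'X^m) * ((1 - 'X^(d * m)) * h) * (f * f)) :> {poly R}.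
    by rewrite [(2 * m)%N]mulnC exprM; ring.
  by rewrite -[X in congX _ _ X]mul1r; apply: congXM => //; apply: geomM1BX.
apply: (congX_trans _ D_eq); rewrite -[X in congX _ _ X]mulrA; apply: congXM => //.
apply: (congX_trans (Delta_numerator k N * U * V)); first exact: congXM.
by rewrite -mulrA -[X in congX _ _ X]mulr1; apply: congXM.
Qed.

(** Factor by factor, (1-q)[a] = 1 - q^a cancels the geometric series in q^a. *)
Lemma congX_prod_repunit_geom N S : all (leq 1) S ->
  congX N.+1 ((1 - 'X) ^+ size S * (\prod_(a <- S) repunit a) * \prod_(a <- S) geom N a)
    (1 : {poly R}).
Proof.
elim: S => [_|a S IHS] /=; first by rewrite !big_nil !mulr1.
case/andP=> a_gt0 S_gt0; rewrite !big_cons exprS -[X in congX _ _ X]mulr1.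
set s := (1 - 'X) ^+ _; set t := \prod_(b <- S) repunit b; set u := \prod_(b <- S) geom N b.
have -> : (1 - 'X) * s * (repunit a * t) * (geom N a * u)
    = (1 - 'X^a) * geom N a * (s * t * u).
  by rewrite -repunitM1BX; ring.
by apply: congXM; [apply: geomM1BX | apply: IHS].
Qed.

Lemma prod_nat_mem N (S : seq nat) (F : nat -> {poly R}) : uniq S -> all (leq 1) S ->
  all (geq N) S -> \prod_(1 <= m < N.+1 | m \in S) F m = \prod_(a <- S) F a.
Proof.
move=> uS S_gt0 S_le; rewrite -big_filter; apply: perm_big.
apply: uniq_perm => [||m]; rewrite ?filter_uniq ?iota_uniq //.
rewrite mem_filter mem_index_iota ltnS andb_idr // => Sm.
by rewrite (allP S_gt0 _ Sm); apply: (allP S_le).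
Qed.

(** Multiplying by [1 - 'X] takes backward differences, so the forward difference at [n] appears in
    degree [n + r]. *)
Lemma coef_iter_difference (D : {poly R}) n r :
  ((1 - 'X) ^+ r * D)`_(n + r) =
    \sum_(i < r.+1) 'C(r, i)%:R * (-1) ^+ (r + i) * D`_(n + i).
Proof.
rewrite exprBn mulr_suml coef_sum (reindex_inj rev_ord_inj) /=.
apply: eq_bigr => i _; have leir : (i <= r)%N by rewrite -ltnS.
rewrite subSS subKn // bin_sub // expr1n mulr1.
have -> : (-1) ^+ (r - i) = ((-1) ^+ (r + i))%:P :> {poly R}.
  by rewrite rmorphXn rmorphN1 -signr_odd -[RHS]signr_odd oddB // oddD.
rewrite -mulr_natl -polyC_natr -!mulrA !coefCM coefXnM ltnNge.
have -> : (r - i <= n + r)%N by lia.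
by congr (_ * (_ * D`_ _)); lia.
Qed.

End Decomposition.

(** * Positivity of the r-th difference *)

Theorem theorem1p4 (k r : nat) : (1 <= k)%N -> (1 <= r)%N ->
  exists N : nat, forall n : nat, (N <= n)%N ->
    0 < \sum_(i < r.+1) ('C(r, i))%:Z * (-1) ^+ (r + i) * Delta k (n + i).
Proof.
move=> _ _.
have [S [sS uS S_gt0 bS]] := exists_bounded_inv_repunits rat (r + 4).
have S1_gt0 : 0 < (\prod_(a <- S) repunit a : {poly rat}).[1].
  rewrite horner_prod big_seq prodr_gt0 // => a Sa.
  by rewrite repunit1 ltr0n (allP S_gt0).
have [J [M M_ge0 G_lb]] := coef_inv_lower_bound rat _ bS S1_gt0.
(* The constant 3 counts the products making up [B]; each adds at most i^2 to the logarithmic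
   derivative. *)
have [N0 conv_gt0] := convolution_gt0 rat J M 3 M_ge0 isT.
(* The maximum ensures that all factors indexed by [S] occur in the truncated product. *)
exists (N0 + \max_(a <- S) a)%N => n len.
pose N := (n + r)%N.
have S_le : all (geq N) S.
  apply/allP => a Sa /=; rewrite (@leq_trans (\max_(b <- S) b)) //.
    by rewrite (big_rem a) //= leq_maxl.
  by rewrite /N; lia.
pose g (m : nat) : {poly rat} := geom N m.
pose G : {poly rat} := (1 - 'X) ^+ r * \prod_(1 <= m < N.+1 | m \in S) g m.
(* One of the two products of geometric series stays whole; the other gives its factors in [S] to
   [G]. *)
pose B := Delta_numerator rat k N * \prod_(1 <= m < N.+1) g m
            * \prod_(1 <= m < N.+1 | m \notin S) g m.
have GB : congX N.+1 ((1 - 'X) ^+ r * Delta_polyR rat k N) (G * B).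
  have := congX_Delta_polyR_positive rat k N.
  move/(congXM _ _ _ _ _ _ (congX_refl _ N.+1 ((1 - 'X) ^+ r))) => D_eq.
  apply: (congX_trans _ D_eq).
  rewrite [X in _ * (_ * X)](bigID (mem S)) /= -/g.
  have -> : forall a b c d e : {poly rat}, a * (b * c * (d * e)) = a * d * (b * c * e).
    by move=> *; ring.
  exact: congX_refl.
have invG : congX N.+1 ((1 - 'X) ^+ 4 * (\prod_(a <- S) repunit a) * G) 1.
  apply: (congX_trans _ _ (congX_prod_repunit_geom rat N S S_gt0)).
  rewrite sS exprD /G prod_nat_mem //.
  have -> : forall a b c d : {poly rat}, a * c * (b * d) = b * a * c * d.
    by move=> *; ring.
  exact: congX_refl.
pose c := \sum_(1 <= m < ((2 * k + 1) * N).+1 | ~~ (2 * k + 1 %| m)%N) (m%:R *: 'X^m)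
  + \sum_(1 <= m < N.+1) (m%:R *: 'X^m * g m)
  + \sum_(1 <= m < N.+1 | m \notin S) (m%:R *: 'X^m * g m).
have [B_ge0 B0_gt0 B_c] : logderiv_le rat N B c.
  do ![apply: logderiv_leM]; apply: logderiv_le_prod => m m_gt0.
  - exact: logderiv_le_1DXn.
  - exact: logderiv_le_geom.
  - exact: logderiv_le_geom.
have c_le i : (i <= N)%N -> c`_i <= 3 * (i ^ 2)%:R.
  move=> leiN; have geom_le m : (0 < m)%N -> (m%:R *: 'X^m * g m)`_i <= i%:R * (m <= i)%N%:R.
    by move=> m_gt0; apply: coef_logderiv_geom.
  have -> : 3 * (i ^ 2)%:R = (i ^ 2)%:R + (i ^ 2)%:R + (i ^ 2)%:R :> rat by ring.
  rewrite !coefD !lerD //; apply: coef_sum_le_sqr => // m _.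
  exact: coef_logderiv_1DXn.
have pos : 0 < \sum_(i < N.+1) G`_i * B`_(N - i).
  apply: (conv_gt0 N (nth 0 G) (nth 0 B)) => // [|m lemN|i leiN|i /andP[leJi leiN]].
  - by rewrite /N; lia.
  - apply: le_trans (B_c m lemN) _; rewrite coefM mulr_sumr ler_sum // => i _.
    by rewrite mulrA ler_wpM2r // c_le // (leq_trans _ lemN) // -ltnS.
  - by have [] := G_lb N.+1 G invG i leiN.
  - by have [_] := G_lb N.+1 G invG i leiN; apply.
have DeltaE i : (i <= r)%N -> (Delta_polyR rat k N)`_(n + i) = (Delta k (n + i))%:~R.
  move=> leir; rewrite (congX_Delta_polyR rat k (n + i)) ?leq_add2l //.
  by rewrite -map_Delta_poly coef_map.
rewrite -(@ltr0z rat) rmorph_sum /=.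
move: pos; rewrite -coefM -GB // coef_iter_difference.
congr (0 < _); apply: eq_bigr => i _.
by rewrite DeltaE -1?ltnS // !rmorphM rmorphXn rmorphN1.
Qed.
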